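(* Let $(X,T)$ be a topological dynamical system with compatible metric $d$ on $X$, and let $K$ be a non-empty compact subset of $X$. Then $$\overline{mdim}_{FK}^B(T,K,d)=\limsup_{\epsilon\to 0}\frac{\sup\{\underline{h}_{\mu}^{FK}(T,\epsilon):\mu\in M(X),\ \mu(K)=1\}}{\log\frac{1}{\epsilon}}.$$
   Context: A topological dynamical system $(X,T)$ is a compact metric space $X$ with metric $d$ together with a continuous map $T:X\to X$. $M(X)$ is the set of all Borel probability measures on $X$. **Feldman–Katok metric.** For $x,y\in X$, $\delta>0$, $n\in\mathbb{N}$ (positive integer), an $(n,\delta)$-match of $x$ and $y$ is an order preserving bijection $\pi:D(\pi)\to R(\pi)$ (i.e. $\pi(i)<\pi(j)$ whenever $i<j$) with $D(\pi),R(\pi)\subset\{0,1,\dots,n-1\}$ such that $d(T^ix,T^{\pi(i)}y)<\delta$ for every $i\in D(\pi)$. Let $|\pi|$ be the cardinality of $D(\pi)$, and put $$\bar f_{n,\delta}(x,y)=1-\frac{\max\{|\pi|:\pi\text{ is an }(n,\delta)\text{-match of }x\text{ and }y\}}{n},\qquad d_{FK_n}(x,y)=\inf\{\delta>0:\bar f_{n,\delta}(x,y)<\delta\}.$$ For $\epsilon>0$ let $B_{FK_n}(x,\epsilon)=\{y\in X:d_{FK_n}(x,y)<\epsilon\}$. **FK-Bowen metric mean dimension.** For $Z\subset X$, $\epsilon>0$, $N\in\mathbb{N}$, $s\in\mathbb{R}$, let $$M_{FK}(T,d,Z,s,N,\epsilon)=\inf\Big\{\sum_{i\in I}e^{-n_is}\Big\},$$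 the infimum over all finite or countable covers $\{B_{FK_{n_i}}(x_i,\epsilon)\}_{i\in I}$ of $Z$ with $n_i\ge N$, $x_i\in X$. This is non-decreasing in $N$; set $M_{FK}(T,d,Z,s,\epsilon)=\lim_{N\to\infty}M_{FK}(T,d,Z,s,N,\epsilon)$. As $s$ varies this jumps from $\infty$ to $0$ at a critical value $$M_{FK}(T,d,Z,\epsilon)=\inf\{s:M_{FK}(T,d,Z,s,\epsilon)=0\}=\sup\{s:M_{FK}(T,d,Z,s,\epsilon)=+\infty\}.$$ Define $$\overline{mdim}_{FK}^B(T,Z,d)=\limsup_{\epsilon\to0}\frac{M_{FK}(T,d,Z,\epsilon)}{\log\frac1\epsilon}.$$ **Lower local entropy.** For $\mu\in M(X)$ and $\epsilon>0$, $$\underline{h}_{\mu}^{FK}(T,x,\epsilon)=\liminf_{n\to\infty}-\frac{\log\mu(B_{FK_n}(x,\epsilon))}{n},\qquad \underline{h}_{\mu}^{FK}(T,\epsilon)=\int\underline{h}_{\mu}^{FK}(T,x,\epsilon)\,d\mu(x).$$ *)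

(* Defs.v *)
From HB Require Import structures.
From mathcomp Require Import all_boot all_order all_algebra.
From mathcomp Require Import all_classical all_reals all_analysis.

Set Implicit Arguments.
Unset Strict Implicit.
Unset Printing Implicit Defensive.

Import Order.TTheory GRing.Theory Num.Theory.
Import numFieldNormedType.Exports.

Local Open Scope classical_set_scope.
Local Open Scope ring_scope.

(* [measurableType] extends [pointedType], so the Borel sigma-algebra can only
   be put on a metric space with a designated point. The point is used
   nowhere: any inhabited metric space can be given one. *)
#[short(type="pmetricType")]
HB.structure Definition PointedMetric (K : numDomainType) :=
  {M of Metric K M & Pointed M}.

Section FeldmanKatok.
Context {R : realType} {X : pmetricType R}.
Implicit Types (T : X -> X) (n N : nat) (x y : X) (Z : set X) (s delta eps : R).

(* A match pi is encoded by its domain D(pi) and any total extension of pi;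
   R(pi) is the image of D(pi), onto which pi is bijective because it is
   strictly increasing on D(pi). *)
Definition FKmatch T n delta x y
    (p : {set 'I_n} * {ffun 'I_n -> 'I_n}) : bool :=
  [forall i in p.1, forall j in p.1, (i < j)%N ==> (p.2 i < p.2 j)%N] &&
  [forall i in p.1, mdist (iter i T x) (iter (p.2 i) T y) < delta].

Definition FKfbar T n delta x y : R :=
  1 - (\max_(p | @FKmatch T n delta x y p) #|p.1|)%N%:R / n%:R.

Definition FKdist T n x y : R :=
  inf [set delta | 0 < delta /\ FKfbar T n delta x y < delta].

Definition FKball T n x eps : set X := [set y | FKdist T n x y < eps].

Local Open Scope ereal_scope.

(* Finite and countable families are those indexed by a subset of nat. *)
Definition FKcover_sums T Z s N eps : set (\bar R) :=
  [set t | exists (I : set nat) (n : nat -> nat) (x : nat -> X),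
    [/\ forall i, I i -> (0 < n i)%N /\ (N <= n i)%N,
        Z `<=` \bigcup_(i in I) FKball T (n i) (x i) eps &
        t = \esum_(i in I) (expR (- ((n i)%:R * s)))%:E]].

Definition FKM_N T Z s N eps : \bar R := ereal_inf (FKcover_sums T Z s N eps).

Definition FKM T Z s eps : \bar R := limn (fun N => FKM_N T Z s N eps).

Definition FKM_critical T Z eps : \bar R :=
  ereal_inf [set s%:E | s in [set s : R | FKM T Z s eps = 0]].

Definition FK_upper_mdim_Bowen T Z : \bar R :=
  limf_esup (fun eps : R => FKM_critical T Z eps / (ln (1 / eps))%:E) 0%R^'+.

Definition borel_probability := probability (g_sigma_algebraType (@open X)) R.

(* The value at n = 0 is junk, which the liminf ignores. *)
Definition FK_local_entropy (mu : borel_probability) T x eps : \bar R :=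
  limn_einf (fun n => - (lne (mu (FKball T n x eps)) / n%:R%:E)).

Definition FK_entropy (mu : borel_probability) T eps : \bar R :=
  \int[mu]_x FK_local_entropy mu T x eps.

End FeldmanKatok.

Arguments borel_probability {R} X.

(* Main.v *)
From HB Require Import structures.
Require Import Defs.
From mathcomp Require Import all_boot all_order all_algebra finmap.
From mathcomp Require Import all_classical all_reals all_analysis measurable_realfun.
From mathcomp Require Import ring lra.
Import Order.TTheory GRing.Theory Num.Theory.
Import numFieldNormedType.Exports.
Local Open Scope classical_set_scope.
Local Open Scope ring_scope.

Set Implicit Arguments.
Unset Strict Implicit.
Unset Printing Implicit Defensive.

(** Write [M e] for the critical exponent [FKM_critical T K e] and [H e] for
    the supremum of the entropies [FK_entropy mu T e] over the probabilities
    carried by [K]. The theorem follows from the two comparisons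

      [H (2 e) <= M e]   and   [M (2 e) <= H e],

    because replacing [e] by [e / 2] changes [ln (1 / e)] by the constant
    [ln 2], which is negligible as [e] tends to 0 ([limf_esup_log_le]).

    First comparison ([FK_entropy_le]), a mass distribution argument. If the
    local entropy at scale [2 e] exceeds [s] at a point [y], then the balls
    [B_n(y, 2 e)] have mass at most [exp (- n s)] for all large [n]. A ball
    [B_n(x, e)] that meets such a point lies in [B_n(y, 2 e)], so a cover of
    cost less than [d] by balls of radius [e] bounds the outer mass of the set
    of such points by [d]. If the covering quantity of exponent [s] vanishes,
    this set is therefore null and the entropy is at most [s].

    Second comparison ([critical_le_sup_entropy]), a Frostman lemma. Take
    [s < s' < M (2 e)]. Allow weighted covers, in which a ball [B_n(x, e)]
    counts with a coefficient [c >= 0] and the coefficients must sum to at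
    least 1 over every point of [K]. Their cost is bounded below
    ([weighted_cover_le]): at every point some level [n] carries a share
    [exp (- n (s' - s))] of the total weight, up to a constant, and the points
    served by level [n] are covered by balls of radius [2 e] around a maximal
    separated set, whose cardinality is controlled by the total weight at that
    level. The optimal cost of a weighted cover dominating a function is a
    sublinear functional; Hahn-Banach provides a linear functional below it,
    hence a finitely additive set function giving mass at most
    [C exp (- n s)] to every ball [B_n(x, e)] with [n] large, and total mass 1
    to [K]. Compactness turns it into a Borel probability without increasing
    the mass of open sets ([finitely_additive_regularization]), and the
    entropy of this probability at scale [e] is at least [s].

    The functionals live on the space of functions with finitely many values,
    which contains all indicators, so that the finitely additive set function is
    read off directly. *)

(** * Feldman-Katok balls *)

Section FKballs.
Context {R : realType} {X : pmetricType R}.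
Implicit Types (T : X -> X) (n : nat) (x y z : X) (e : R).

(** The strict inequality in the definition of a ball passes through the
    infimum, so that membership is witnessed by a single match. *)
Lemma FKballP T n x e y :
  FKball T n x e y <-> exists d : R, [/\ 0 < d, d < e &
    exists2 p : {set 'I_n} * {ffun 'I_n -> 'I_n}, FKmatch T d x y p &
      1 - #|p.1|%:R / n%:R < d].
Proof.
rewrite /FKball /= /FKdist; set S := [set d | _].
have S_inf : has_inf S.
  split; last by exists 0 => d [/ltW].
  (* the default value of the infimum never matters: 2 always qualifies *)
  exists 2; split; first by rewrite ltr0n.
  rewrite /FKfbar; apply: (@le_lt_trans _ _ 1); last by rewrite ltr1n.
  by rewrite gerBl divr_ge0.
split=> [/(inf_lt S_inf.1)[d [d0 fd] de]|[d [d0 de [p pm pd]]]].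
  exists d; split=> //; move: fd; rewrite /FKfbar.
  have m0 : FKmatch T d x y
      ((finset.set0, [ffun i => i]) : {set 'I_n} * {ffun 'I_n -> 'I_n}).
    by apply/andP; split; apply/forallP => i; rewrite inE.
  have card_m : (0 < #|[pred p | @FKmatch _ _ T n d x y p]|)%N.
    by apply/card_gt0P; eexists; exact: m0.
  have [p pm ->] :=
    eq_bigmax_cond (fun p : {set 'I_n} * {ffun 'I_n -> 'I_n} => #|p.1|) card_m.
  by exists p.
apply: le_lt_trans de; apply: ge_inf; first exact: S_inf.2.
split=> //; apply: le_lt_trans pd; rewrite lerD2l lerN2 ler_wpM2r//.
by rewrite ler_nat; exact: (leq_bigmax_cond _ pm).
Qed.

Lemma FKball_center T n x e : (0 < n)%N -> 0 < e -> FKball T n x e x.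
Proof.
move=> n0 e0; apply/FKballP; exists (e / 2); split; [lra|lra|].
exists (finset.setTfor _, [ffun i => i]) => /=.
  apply/andP; split; apply/forallP => i; apply/implyP => _ /=.
    by apply/forallP => j; rewrite inE/= !ffunE; exact/implyP.
  by rewrite ffunE mdistxx; lra.
by rewrite cardsT card_ord divff ?pnatr_eq0 -?lt0n//; lra.
Qed.

(** Matches of [x] with [y] and of [x] with [z] compose through the indices
    they share; by inclusion-exclusion at least [#|p.1| + #|q.1| - n] indices
    are shared. *)
Lemma FKmatch_comp T n x y z (d d' : R) (p q : {set 'I_n} * {ffun 'I_n -> 'I_n}) :
  FKmatch T d x y p -> FKmatch T d' x z q ->
  exists2 r : {set 'I_n} * {ffun 'I_n -> 'I_n}, FKmatch T (d + d') y z r &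
    (#|p.1| + #|q.1| <= #|r.1| + n)%N.
Proof.
move=> /andP[/forall_inP pinc /forall_inP pd] /andP[/forall_inP qinc /forall_inP qd].
have {}pinc i j : i \in p.1 -> j \in p.1 -> (i < j)%N -> (p.2 i < p.2 j)%N.
  by move=> ip jp; apply/implyP; move/forall_inP : (pinc i ip); exact.
have {}qinc i j : i \in q.1 -> j \in q.1 -> (i < j)%N -> (q.2 i < q.2 j)%N.
  by move=> ip jp; apply/implyP; move/forall_inP : (qinc i ip); exact.
have pmono i j : i \in p.1 -> j \in p.1 -> (p.2 i < p.2 j)%N -> (i < j)%N.
  move=> ip jp; apply: contraLR; rewrite -!leqNgt leq_eqVlt.
  by move=> /predU1P[/val_inj->//|/(pinc j i jp ip)/ltnW].
have pinj : {in p.1 &, injective p.2}.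
  move=> i j ip jp pij; apply/val_inj/eqP.
  case: ltngtP => // ij; [have := pinc _ _ ip jp ij|have := pinc _ _ jp ip ij].
    by rewrite pij ltnn.
  by rewrite pij ltnn.
pose I := p.1 :&: q.1.
have subp : {subset I <= p.1} by move=> i /setIP[].
have subq : {subset I <= q.1} by move=> i /setIP[].
(* the inverse of [p.2] on the image of [I] *)
pose inv j := odflt j [pick i in I | p.2 i == j].
have invK i : i \in I -> inv (p.2 i) = i.
  move=> iI; rewrite /inv; case: pickP => [k /andP[kI /eqP]|/(_ i)].
    by apply: pinj; exact: subp.
  by rewrite iI eqxx.
exists (p.2 @: I, [ffun j => q.2 (inv j)]) => /=.
  apply/andP; split; apply/forall_inP => _ /imsetP[i iI ->] /=.
    apply/forall_inP => _ /imsetP[j jI ->]; apply/implyP.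
    rewrite !ffunE !invK// => pij; apply: qinc; [exact: subq|exact: subq|].
    by apply: pmono => //; exact: subp.
  rewrite ffunE invK//.
  have /= h1 := pd i (subp _ iI); have /= h2 := qd i (subq _ iI).
  apply: le_lt_trans (metric_triangle _ (iter i T x) _) _.
  by rewrite ltrD// metric_sym.
rewrite card_in_imset; last by move=> i j /subp ? /subp; exact: pinj.
rewrite -cardsUI addnC leq_add2l.
by rewrite -[X in (_ <= X)%N]card_ord max_card.
Qed.

(** This form, with two points in a ball around a third, contains both the
    symmetry of the distance and its triangle inequality. *)
Lemma FKball_triangle T n x y z e e' :
  FKball T n x e y -> FKball T n x e' z -> FKball T n y (e + e') z.
Proof.
move=> /FKballP[d [d0 de [p pm pd]]] /FKballP[d' [d'0 de' [q qm qd]]].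
apply/FKballP; exists (d + d'); split; [lra|lra|].
have [r rm rn] := FKmatch_comp pm qm; exists r => //.
apply: le_lt_trans (ltrD pd qd).
case: n => [|n] in p pm pd q qm qd r rm rn *; first by rewrite invr0 !mulr0; lra.
suff : (#|p.1|%:R + #|q.1|%:R) / n.+1%:R <= #|r.1|%:R / n.+1%:R + 1 :> R.
  by rewrite mulrDl; move: (_ / _) (_ / _) (_ / _) => a b c; lra.
rewrite -[X in _ <= _ + X](@divff _ n.+1%:R) ?pnatr_eq0//.
by rewrite -mulrDl ler_wpM2r ?invr_ge0// -!natrD ler_nat.
Qed.

(** A match stays valid under small perturbations of [y], because it imposes
    finitely many strict inequalities on finitely many iterates. *)
Lemma FKball_open T n x e : continuous T -> open (FKball T n x e).
Proof.
move=> cT; rewrite openE => y /FKballP[d [d0 de [p /andP[pinc /forall_inP pd] pn]]].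
have itc k : continuous (iter k T).
  elim: k => [|k ih] z; first by move=> A.
  by apply: (@continuous_comp _ _ _ (iter k T) T); [exact: ih|exact: cT].
have near_i (i : 'I_n) : \forall z \near y,
    i \in p.1 -> mdist (iter i T x) (iter (p.2 i) T z) < d.
  have [ip|/negP ip] := boolP (i \in p.1); last by apply: nearW => z ?.
  have r0 : 0 < d - mdist (iter i T x) (iter (p.2 i) T y) by rewrite subr_gt0 pd.
  have : \forall z \near y, ball (iter (p.2 i) T y)
      (d - mdist (iter i T x) (iter (p.2 i) T y)) (iter (p.2 i) T z).
    by apply: (itc (p.2 i) y); exact: near_ball.
  rewrite ballEmdist; apply: filterS => z /= h _.
  apply: le_lt_trans (metric_triangle _ (iter (p.2 i) T y) _) _.
  by rewrite -ltrBrDl.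
have := filter_forall _ near_i; move=> H; apply: filterS (H _) => z h.
apply/FKballP; exists d; split=> //; exists p => //; apply/andP; split=> //.
exact/forall_inP.
Qed.

End FKballs.

(** * Linear functionals below a sublinear one *)

Section HahnBanach.
Context {R : realType} {V : lmodType R}.
Implicit Types (p q : V -> R) (x y : V).

Definition sublinear p : Prop :=
  (forall x y, p (x + y) <= p x + p y) /\
  (forall (s : R) x, 0 < s -> p (s *: x) <= s * p x).

Lemma sublinearZ p (s : R) x : sublinear p -> 0 < s -> p (s *: x) = s * p x.
Proof.
move=> [_ pZ] s0; apply/eqP; rewrite eq_le pZ//=.
have := pZ s^-1 (s *: x); rewrite invr_gt0 => /(_ s0).
by rewrite scalerA mulVf ?gt_eqF// scale1r -ler_pdivlMl.
Qed.

Lemma sublinear0 p : sublinear p -> p 0 = 0.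
Proof. by move=> sp; have := sublinearZ 0 sp (ltr0n R 2); rewrite scaler0; lra. Qed.

Lemma sublinearN_le p x : sublinear p -> - p (- x) <= p x.
Proof. by move=> sp; have := sp.1 x (- x); rewrite subrr sublinear0//; lra. Qed.

(** The largest sublinear functional below [q] that is affine along the
    direction [y], with slope [q y]. *)
Definition shift q y x : R :=
  inf [set q (x + t *: y) - t * q y | t in [set t : R | 0 <= t]].

Section shift_theory.
Variables (q : V -> R) (sq : sublinear q) (y : V).

Lemma shift_lb x (t : R) : 0 <= t -> shift q y x <= q (x + t *: y) - t * q y.
Proof.
move=> t0; apply: ge_inf; last by exists t.
exists (- q (- x)) => _ [u u0 <-].
have := sq.1 (x + u *: y) (- x); rewrite addrC addKr.
have [<-|un0] := eqVneq 0 u.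
  by rewrite scale0r sublinear0// mul0r addr0; lra.
by rewrite sublinearZ ?lt_neqAle ?un0//; lra.
Qed.

Lemma shift_glb x (c : R) :
  (forall t : R, 0 <= t -> c <= q (x + t *: y) - t * q y) -> c <= shift q y x.
Proof.
move=> h; apply: lb_le_inf; last by move=> _ [t t0 <-]; exact: h.
by exists (q (x + 0 *: y) - 0 * q y), 0 => //=.
Qed.

Lemma shift_le x : shift q y x <= q x.
Proof. by have := shift_lb x (lexx 0); rewrite scale0r addr0 mul0r subr0. Qed.

Lemma shift_sublinear : sublinear (shift q y).
Proof.
split=> [x z|s x s0].
  rewrite -lerBlDr; apply: shift_glb => t t0; rewrite lerBlDr -lerBlDl.
  apply: shift_glb => u u0.
  have := shift_lb (x + z) (addr_ge0 t0 u0).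
  have := sq.1 (x + t *: y) (z + u *: y).
  by rewrite addrACA -scalerDl mulrDl; lra.
rewrite -ler_pdivrMl//; apply: shift_glb => t t0; rewrite ler_pdivrMl//.
have := shift_lb (s *: x) (mulr_ge0 (ltW s0) t0).
by rewrite -scalerA -scalerDr (sublinearZ _ sq)// mulrBr mulrA.
Qed.

Lemma shift_opp : shift q y (- y) <= - q y.
Proof.
by have := shift_lb (- y) ler01; rewrite scale1r addNr sublinear0//; lra.
Qed.

End shift_theory.

(** Zorn's lemma applies because the pointwise infimum of a chain of sublinear
    functionals below [p] is finite, being bounded below by [- p (- x)], and
    sublinear. *)
Lemma minimal_sublinear p : sublinear p ->
  exists q, [/\ sublinear q, forall x, q x <= p x &
    forall r, sublinear r -> (forall x, r x <= q x) -> r = q].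
Proof.
move=> sp.
pose S := {q : V -> R | sublinear q /\ forall x, q x <= p x}.
pose le (q r : S) := `[< forall x, sval r x <= sval q x >].
have [||||[q [sq qp]] qmin] := @Zorn S le.
- by move=> q; apply/asboolP.
- move=> q r s /asboolP qr /asboolP rs; apply/asboolP => x.
  exact: le_trans (rs x) (qr x).
- move=> [q hq] [r hr] /asboolP/= qr /asboolP/= rq; apply: eq_exist.
  by apply/funext => x; apply/eqP; rewrite eq_le qr rq.
- move=> A Atot; have [->|/set0P[q0 Aq0]] := eqVneq A set0.
    by exists (exist _ p (conj sp (fun=> lexx _))).
  pose r x := inf [set sval q x | q in A].
  have r_lb x (q : S) : A q -> r x <= sval q x.
    move=> Aq; apply: ge_inf; last by exists q.
    exists (- p (- x)) => _ [[s [ss sp']] _ <-] /=.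
    by apply: le_trans (sublinearN_le x ss); rewrite lerN2.
  have r_glb x c : (forall q : S, A q -> c <= sval q x) -> c <= r x.
    move=> h; apply: lb_le_inf; last by move=> _ [q Aq <-]; exact: h.
    by exists (sval q0 x), q0.
  suff hr : sublinear r /\ forall x, r x <= p x.
    by exists (exist _ r hr) => q Aq; apply/asboolP => x /=; exact: r_lb.
    split; last by move=> x; exact: le_trans (r_lb x _ Aq0) ((svalP q0).2 x).
  split=> [x y|s x s0].
    rewrite -lerBlDr; apply: (r_glb) => q Aq; rewrite lerBlDr -lerBlDl.
    apply: (r_glb) => u Au; rewrite lerBlDl.
    have [/asboolP h|/asboolP h] := Atot _ _ Aq Au.
      apply: le_trans (r_lb _ _ Au) _.
      by apply: le_trans ((svalP u).1.1 x y) _; rewrite lerD.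
    apply: le_trans (r_lb _ _ Aq) _.
    by apply: le_trans ((svalP q).1.1 x y) _; rewrite lerD.
  rewrite -ler_pdivrMl//; apply: (r_glb) => q Aq; rewrite ler_pdivrMl//.
  by rewrite -(sublinearZ x (svalP q).1 s0); exact: r_lb.
exists q; split=> // r sr rq.
have hr : sublinear r /\ forall x, r x <= p x.
  by split=> // x; exact: le_trans (rq x) (qp x).
have /= := qmin (exist _ r hr); rewrite /le => /(_ ltac:(exact/asboolP)).
by case.
Qed.

(** A minimal sublinear functional [L] coincides with all its shifts, which
    forces additivity. Starting the minimization from the shift of [p] along
    [v] makes [L (- v) <= - p v], hence [L v = p v]. *)
Lemma Hahn_Banach p v : sublinear p ->
  exists L : V -> R, [/\ forall x y, L (x + y) = L x + L y,
    forall x, L x <= p x & L v = p v].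
Proof.
move=> sp; have [L [sL Lle Lmin]] := minimal_sublinear (shift_sublinear sp v).
have shiftL y x : L x = shift L y x.
  by rewrite (Lmin (shift L y) (shift_sublinear sL y))// => z; exact: shift_le.
have LN y : L (- y) = - L y.
  apply/eqP; rewrite eq_le {1}(shiftL y) shift_opp//=.
  by rewrite lerNl; have := sublinearN_le y sL; lra.
have Lp x : L x <= p x by exact: le_trans (Lle x) (shift_le sp v x).
exists L; split=> // [x y|].
  apply/eqP; rewrite eq_le sL.1/=.
  have := shift_lb sL y x ler01; rewrite -(shiftL y) scale1r mul1r; lra.
apply/eqP; rewrite eq_le Lp/= -lerN2 -LN.
exact: le_trans (Lle _) (shift_opp sp v).
Qed.

End HahnBanach.

(** * From finitely additive set functions to Borel probabilities *)

Section Regularization.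
Local Open Scope ereal_scope.
Context {R : realType} {X : ptopologicalType}.
Hypotheses (hX : hausdorff_space X) (cX : compact [set: X]).
Variable l : set X -> R.
Hypotheses (l_ge0 : forall A, (0 <= l A)%R)
  (l_additive : forall A B, A `&` B = set0 -> l (A `|` B) = (l A + l B)%R)
  (l_setT : l setT = 1%R).
Implicit Types (A B C U V : set X).

Let l_set0 : l set0 = 0%R.
Proof. by have := l_additive (setI0 set0); rewrite setU0; lra. Qed.

Let l_le A B : A `<=` B -> (l A <= l B)%R.
Proof.
move=> AB; rewrite -(setDUK AB) l_additive ?lerDl//.
by apply/seteqP; split=> // x [Ax [_ nAx]].
Qed.

Let l_setU A B : (l (A `|` B) <= l A + l B)%R.
Proof.
have -> : A `|` B = A `|` (B `\` A).
  apply/seteqP; split=> x [Ax|Bx]; [by left| |by left|by right; case: Bx].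
  by have [Ax|nAx] := pselect (A x); [left|right].
rewrite l_additive; last by apply/seteqP; split=> // x [Ax [_ nAx]].
by rewrite lerD2l; apply: l_le => x [].
Qed.

(** The mass of an open set is recomputed from inside by closed sets. This
    may lose mass on open sets but makes the result countably subadditive on open
    sets, by compactness. *)
Definition inner U : \bar R :=
  ereal_sup [set (l C)%:E | C in [set C | closed C /\ C `<=` U]].

Let inner_ub C U : closed C -> C `<=` U -> (l C)%:E <= inner U.
Proof. by move=> cC CU; apply: ereal_sup_ubound; exists C. Qed.

Let inner_ge0 U : 0 <= inner U.
Proof.
by apply: (@le_trans _ _ (l set0)%:E);
  [rewrite lee_fin l_ge0|apply: inner_ub => //; exact: closed0].
Qed.

Let inner_set0 : inner set0 = 0.
Proof.
apply/eqP; rewrite eq_le inner_ge0 andbT; apply: ge_ereal_sup => _ [C [_ C0] <-].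
by move: C0; rewrite subset0 => ->; rewrite l_set0.
Qed.

Let inner_le_l U : inner U <= (l U)%:E.
Proof. by apply: ge_ereal_sup => _ [C [_ CU] <-]; rewrite lee_fin l_le. Qed.

(** A closed subset of [U `|` V] splits into a closed subset of [U] and a closed
    subset of [V] because a compact Hausdorff space is normal. *)
Let inner_setU U V : open U -> open V -> inner (U `|` V) <= inner U + inner V.
Proof.
move=> oU oV; apply: ge_ereal_sup => _ [C [cC CUV] <-].
have cCV : closed (C `&` ~` V) by apply: closedI => //; exact: open_closedC.
have nU : set_nbhs (C `&` ~` V) U.
  move=> x [Cx Vx]; apply: open_nbhs_nbhs; split=> //.
  by case: (CUV _ Cx).
have [W CVW WU] := compact_normal hX cX cCV nU.
have CW : C `<=` (C `&` closure W) `|` (C `&` ~` W°).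
  move=> x Cx; have [Wx|Wx] := pselect (W° x); last by right.
  by left; split=> //; apply: subset_closure; exact: interior_subset.
rewrite (@le_trans _ _ ((l (C `&` closure W))%:E + (l (C `&` ~` W°))%:E))//.
  by rewrite -EFinD lee_fin (le_trans (l_le CW))// l_setU.
apply: leeD; apply: inner_ub.
- by apply: closedI => //; exact: closed_closure.
- by move=> x [_ /WU].
- by apply: closedI => //; apply: open_closedC; exact: open_interior.
- move=> x [Cx Wx]; apply: contrapT => Vx; apply: Wx; exact: CVW.
Qed.

Let inner_bigcup (F : (set X)^nat) : (forall i, open (F i)) ->
  inner (\bigcup_i F i) <= \sum_(i <oo) inner (F i).
Proof.
move=> oF; apply: ge_ereal_sup => _ [C [cC CF] <-].
have : compact C by exact: subclosed_compact cC cX _.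
rewrite compact_cover => /(_ nat setT F (fun i _ => oF i) CF)[D _ CD].
have [n Dn] : exists n, forall i : nat, i \in D -> (i < n)%N.
  exists (\max_(i <- finmap.enum_fset D) i)%N.+1 => i iD; rewrite ltnS.
  exact: (@leq_bigmax_seq _ _ xpredT id).
have inner_bigsetU m : inner (\big[setU/set0]_(i < m) F i) <= \sum_(i < m) inner (F i).
  elim: m => [|m ih]; first by rewrite !big_ord0 inner_set0.
  rewrite !big_ord_recr/=; apply: le_trans (inner_setU _ _) _ => //.
    by rewrite -bigcup_mkord; apply: bigcup_open => ? _; exact: oF.
  by rewrite leeD2r.
apply: (@le_trans _ _ (\sum_(0 <= i < n) inner (F i))); last first.
  by apply: nneseries_lim_ge => i _ _; exact: inner_ge0.
rewrite big_mkord; apply: le_trans (inner_bigsetU n); apply: inner_ub => //.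
move=> x /CD[i iD Fix]; rewrite -bigcup_mkord; exists i => //=; exact: Dn.
Qed.

(** Giving infinite cost to the sets that are not open makes the outer measure
    of all covers the outer measure of open covers. *)
Definition open_cost U : \bar R := if `[< open U >] then inner U else +oo.

Let open_cost0 : open_cost set0 = 0.
Proof. by rewrite /open_cost asboolT//; exact: open0. Qed.

Let open_cost_ge0 U : 0 <= open_cost U.
Proof. by rewrite /open_cost; case: ifP. Qed.

Notation borelT := (g_sigma_algebraType (@open X)).

Definition outer (A : set borelT) : \bar R := @mu_ext _ borelT R open_cost A.

HB.instance Definition _ := @isOuterMeasure.Build R borelT outer
  (@mu_ext0 _ borelT R open_cost open_cost0 open_cost_ge0)
  (@mu_ext_ge0 _ borelT R open_cost open_cost_ge0)
  (@le_mu_ext _ borelT R open_cost)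
  (@mu_ext_sigma_subadditive _ borelT R open_cost open_cost_ge0).

Let outer_open U : open U -> outer U <= inner U.
Proof.
move=> oU; apply: ereal_inf_lbound.
exists (fun n => if n is 0%N then U else set0).
  split; last by move=> x Ux; exists 0%N.
  by case=> [|n]; [exact: sub_sigma_algebra|exact: measurable0].
rewrite nneseries_recl//= eseries0 ?adde0 => [|[]//].
by rewrite /open_cost asboolT.
Qed.

Let outer_lb (A : set X) (c : \bar R) :
  (forall V, open V -> A `<=` V -> c <= inner V) -> c <= outer A.
Proof.
move=> h; apply: le_ereal_inf_tmp => _ [F [_ AF] <-].
have [oF|] := pselect (forall i, open (F i)).
  rewrite (eq_eseriesr (g := fun i => inner (F i))); last first.
    by move=> i _; rewrite /open_cost asboolT.
  by apply: le_trans (inner_bigcup oF); apply: h => //; exact: bigcup_open.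
move=> /existsNP[k oFk]; rewrite (@eseries_pinfty _ _ _ k) ?leey//.
  by move=> n _; rewrite gt_eqF// (lt_le_trans _ (open_cost_ge0 _)).
by rewrite /open_cost asboolF.
Qed.

Let outer_fin A : outer A \is a fin_num.
Proof.
rewrite ge0_fin_numE; last exact: outer_measure_ge0.
apply: (@le_lt_trans _ _ (outer setT)); first exact: le_outer_measure.
apply: le_lt_trans (outer_open openT) _.
by apply: le_lt_trans (inner_le_l _) _; rewrite ltry.
Qed.

Let inner_fin A : inner A \is a fin_num.
Proof.
rewrite ge0_fin_numE; last exact: inner_ge0.
by apply: le_lt_trans (inner_le_l _) _; rewrite ltry.
Qed.

(** Given an open [V] containing [A], fill [V `&` U] up with a closed [C] and
    then [V `\` C] with a closed [D]: these are disjoint, so their masses add up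
    to at most that of [V]. *)
Let open_caratheodory U : open U -> caratheodory_measurable outer U.
Proof.
move=> oU; apply: le_caratheodory_measurable => A.
apply: outer_lb => V oV AV; rewrite -leeBrDr//.
apply: (@le_trans _ _ (inner (V `&` U))).
  apply: le_trans (outer_open (openI oV oU)).
  by apply: le_outer_measure => x [/AV].
apply: ge_ereal_sup => _ [C [cC CVU] <-]; rewrite leeBrDr// addeC -leeBrDr//.
have oVC : open (V `&` ~` C) by apply: openI => //; exact: closed_openC.
apply: (@le_trans _ _ (inner (V `&` ~` C))).
  apply: le_trans (outer_open oVC); apply: le_outer_measure => x [/AV Vx Ux].
  by split=> // /CVU[_].
apply: ge_ereal_sup => _ [D [cD DVC] <-]; rewrite leeBrDr// -EFinD -l_additive.
  apply: inner_ub; first exact: closedU.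
  by move=> x [/DVC[]|/CVU[]].
by apply/seteqP; split=> // x [/DVC[_ nCx] /nCx].
Qed.

Let borel_caratheodory (A : set borelT) :
  measurable A -> caratheodory_measurable outer A.
Proof.
apply: smallest_sub; last exact: open_caratheodory.
split; first exact: caratheodory_measurable_set0.
- by move=> B mB; rewrite setTD; exact: caratheodory_measurable_setC.
- by move=> F mF; exact: caratheodory_measurable_bigcup.
Qed.

Let outer_sigma_additive : semi_sigma_additive (outer : set borelT -> \bar R).
Proof.
move=> F mF tF mUF; apply: caratheodory_measure_sigma_additive => //.
  by move=> i; exact: borel_caratheodory.
exact: borel_caratheodory.
Qed.

HB.instance Definition _ := isMeasure.Build _ borelT R outer
  (outer_measure0 outer) (outer_measure_ge0 outer) outer_sigma_additive.

Let closed_outer C : closed C -> (l C)%:E <= outer C.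
Proof. by move=> cC; apply: outer_lb => V oV; exact: inner_ub. Qed.

Let outer_setT : outer setT = 1.
Proof.
apply/eqP; rewrite eq_le -l_setT closed_outer ?andbT; last exact: closedT.
exact: le_trans (outer_open openT) (inner_le_l _).
Qed.

HB.instance Definition _ := Measure_isProbability.Build _ borelT R outer outer_setT.

(** The inequalities point in opposite directions for open and closed sets, as
    for the limit of a weakly convergent sequence of measures. *)
Lemma finitely_additive_regularization :
  exists mu : probability borelT R,
    (forall U, open U -> mu U <= (l U)%:E) /\
    (forall C, closed C -> (l C)%:E <= mu C).
Proof.
exists outer; split=> [U oU|C cC]; last exact: closed_outer.
exact: le_trans (outer_open oU) (inner_le_l _).
Qed.

End Regularization.

(** * Weighted covers cost as much as covers *)

Section WeightedCovers.
Context {R : realType} {X : pmetricType R}.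
Variable T : X -> X.
Implicit Types (K Z A : set X) (n N : nat) (e s d : R) (x y z : X).
Implicit Types (L : seq (R * (nat * X))).

Lemma FKM_N_le_seq Z s N e (Y : seq (nat * X)) :
  (forall y : nat * X, y \in Y -> (0 < y.1)%N && (N <= y.1)%N) ->
  (forall z, Z z -> exists2 y : nat * X, y \in Y & FKball T y.1 y.2 e z) ->
  (FKM_N T Z s N e <= (\sum_(y <- Y) expR (- (y.1%:R * s)))%:E)%E.
Proof.
move=> YN ZY; pose y0 := (0%N, point : X).
apply: ereal_inf_lbound; exists `I_(size Y).
exists (fun i => (nth y0 Y i).1), (fun i => (nth y0 Y i).2); split.
- by move=> i iY; apply/andP; apply: YN; exact: mem_nth.
- move=> z /ZY[y yY yz]; exists (index y Y); rewrite /= ?index_mem//.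
  by rewrite nth_index.
rewrite esum_fset; [|exact: finite_II|by move=> i _; rewrite lee_fin expR_ge0].
by rewrite -fsbig_ord sumEFin (big_nth y0) big_mkord.
Qed.

(** Only earlier points are tested against the balls of later ones, which is
    what prepending a point to the sequence requires. *)
Definition separated n e (Y : seq X) :=
  pairwise (fun z y => z \notin FKball T n y (e + e)) Y.

(** Two points of a ball of radius [e] are within [2 e] of each other. *)
Lemma separated_indic_le1 n e x (Y : seq X) : separated n e Y ->
  \sum_(y <- Y) \1_(FKball T n x e) y <= 1 :> R.
Proof.
elim: Y => [_|y Y ih]; first by rewrite big_nil.
rewrite /separated pairwise_cons => /andP[/allP yY sepY]; rewrite big_cons.
have [xy|xy] := boolP (y \in FKball T n x e); last first.
  by rewrite indicE (negbTE xy) add0r; exact: ih.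
rewrite big_seq big1 ?addr0; first by rewrite indicE xy.
move=> z zY; rewrite indicE; case: (boolP (z \in FKball T n x e)) => // xz.
have /negP := yY _ zY; case.
by move: xy xz; rewrite !in_setE => xy xz; exact: FKball_triangle xz xy.
Qed.

(** A maximal separated subset [Y] of [A] works: the balls of radius [2 e] around
    it cover [A]. Each ball of the weighted family contains at most one point of
    [Y], whereas every point of [Y] receives weight at least [w], so the size of
    [Y] is bounded by the total weight over [w]; this bound also provides the
    maximal set. *)
Lemma greedy_cover n e (w : R) A L : 0 < w -> (forall l, l \in L -> 0 <= l.1) ->
  (forall z, A z -> w <= \sum_(l <- L) l.1 * \1_(FKball T n l.2.2 e) z) ->
  exists Y : seq X,
    (forall z, A z -> exists2 y, y \in Y & FKball T n y (e + e) z) /\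
    (size Y)%:R * w <= \sum_(l <- L) l.1.
Proof.
move=> w0 L0 wA; set c := \sum_(l <- L) l.1.
pose P k := `[< exists Y, [/\ separated n e Y, forall y, y \in Y -> A y & size Y = k] >].
have size_le Y : separated n e Y -> (forall y, y \in Y -> A y) ->
    (size Y)%:R * w <= c.
  move=> sepY YA.
  apply: (@le_trans _ _ (\sum_(y <- Y) \sum_(l <- L) l.1 * \1_(FKball T n l.2.2 e) y)).
    have -> : (size Y)%:R * w = \sum_(y <- Y) w.
      by rewrite big_const_seq count_predT iter_addr_0 mulr_natl.
    by rewrite big_seq [leRHS]big_seq; apply: ler_sum => y /YA/wA.
  rewrite exchange_big/= /c big_seq [leRHS]big_seq; apply: ler_sum => l lL.
  by rewrite -mulr_sumr ler_piMr ?L0// separated_indic_le1.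
have exP : exists k, P k.
  by exists 0%N; apply/asboolP; exists [::]; split.
have c0 : 0 <= c by rewrite /c big_seq; apply: sumr_ge0 => l /L0.
have ubP k : P k -> (k <= Num.Def.archi_bound (c / w))%N.
  move=> /asboolP[Y [sepY YA <-]]; rewrite -(ler_nat R).
  apply: le_trans (ltW (archi_boundP _)); last exact: divr_ge0 (ltW w0).
  by rewrite ler_pdivlMr// size_le.
case: (ex_maxnP exP ubP) => k /asboolP[Y [sepY YA sizeY]] kmax.
exists Y; split; last exact: size_le.
move=> z Az; apply: contrapT => nz.
suff /kmax : P k.+1 by rewrite ltnn.
apply/asboolP; exists (z :: Y); split=> [||/=]; last by rewrite sizeY.
- rewrite /separated pairwise_cons; apply/andP; split=> //; apply/allP => y yY.
  by apply/negP; rewrite in_setE => yz; apply: nz; exists y.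
- by move=> y; rewrite inE => /predU1P[->//|/YA].
Qed.

Lemma sum_by_level L (F : R * (nat * X) -> R) N m :
  (forall l, l \in L -> (N <= l.2.1 < m)%N) ->
  \sum_(l <- L) F l = \sum_(N <= n < m) \sum_(l <- L | l.2.1 == n) F l.
Proof.
move=> LN; rewrite (exchange_big_dep xpredT)//= big_seq [RHS]big_seq.
apply: eq_bigr => l lL; under eq_bigl do rewrite eq_sym.
by rewrite big_nat1_eq LN.
Qed.

Lemma sum_geometric_lt1 (r : R) N m : 0 < r -> r < 1 ->
  \sum_(N <= n < m) r ^+ n * (1 - r) < 1.
Proof.
move=> r0 r1; have [Nm|mN] := leqP N m; last by rewrite big_geq ?ltr01// ltnW.
rewrite (eq_bigr (fun n => (- r ^+ n.+1) - (- r ^+ n))).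
  rewrite (telescope_sumr (fun n => - r ^+ n))//.
  have := exprn_gt0 m r0; have := exprn_ile1 N (ltW r0) (ltW r1); lra.
by move=> n _; rewrite exprSr; lra.
Qed.

(** With [r = exp (- d)], the shares [r ^ n (1 - r)] sum to less than 1, so
    every point of [K] receives at least the share of level [n] from the balls
    of some level [n]. Covering greedily level by level, the loss of a factor
    [r ^ - n] in the number of balls is compensated by the increase of the
    exponent from [s] to [s + d]. *)
Lemma weighted_cover_le K N e s d L : (0 < N)%N -> 0 < d ->
  (forall l, l \in L -> (0 <= l.1) && (N <= l.2.1)%N) ->
  (forall z, K z -> 1 <= \sum_(l <- L) l.1 * \1_(FKball T l.2.1 l.2.2 e) z) ->
  (FKM_N T K (s + d) N (e + e) <=
   ((\sum_(l <- L) l.1 * expR (- (l.2.1%:R * s))) / (1 - expR (- d)))%:E)%E.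
Proof.
move=> N0 d0 LN LK; set r := expR (- d).
have r0 : 0 < r by exact: expR_gt0.
have r1 : r < 1 by rewrite expR_lt1 oppr_lt0.
pose m := (\max_(l <- L) l.2.1).+1.
have Lm l : l \in L -> (N <= l.2.1 < m)%N.
  move=> lL; have /andP[_ ->] := LN _ lL.
  by rewrite ltnS (leq_bigmax_seq (F := fun l => l.2.1)).
pose A n := [set z | K z /\ r ^+ n * (1 - r) <=
  \sum_(l <- L | l.2.1 == n) l.1 * \1_(FKball T n l.2.2 e) z].
have w0 n : 0 < r ^+ n * (1 - r) by rewrite mulr_gt0 ?exprn_gt0 ?subr_gt0.
have /choice[Y YP] n : exists Y : seq X,
    (forall z, A n z -> exists2 y, y \in Y & FKball T n y (e + e) z) /\
    (size Y)%:R * (r ^+ n * (1 - r)) <= \sum_(l <- L | l.2.1 == n) l.1.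
  rewrite -big_filter; apply: greedy_cover => // [l|z [_]].
    by rewrite mem_filter => /andP[_ /LN/andP[]].
  by rewrite big_filter.
pose C := [seq (n, y) | n <- index_iota N m, y <- Y n].
apply: (@le_trans _ _ (\sum_(y <- C) expR (- (y.1%:R * (s + d))))%:E).
  apply: FKM_N_le_seq => [_ /allpairsPdep[n [y [nN _ ->]]]|z Kz] /=.
    by move: nN; rewrite mem_index_iota => /andP[Nn _]; rewrite Nn (leq_trans N0 Nn).
  have [n nN Az] : exists2 n, n \in index_iota N m & A n z.
    apply: contrapT => nA.
    have := LK _ Kz; rewrite (sum_by_level _ Lm) leNgt => /negP; apply.
    apply: le_lt_trans (sum_geometric_lt1 N m r0 r1).
    rewrite big_seq [leRHS]big_seq; apply: ler_sum => n nN.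
    rewrite leNgt; apply/negP => /ltW An; apply: nA; exists n => //; split=> //.
    by apply: le_trans An _; apply: ler_sum => l /eqP->.
  have [y yY yz] := (YP n).1 _ Az; exists (n, y) => //.
  by apply/allpairsPdep; exists n, y.
rewrite lee_fin big_allpairs_dep/= (sum_by_level _ Lm) mulr_suml.
apply: ler_sum => n _; rewrite ler_pdivlMr ?subr_gt0//.
rewrite (eq_bigr (fun l => l.1 * expR (- (n%:R * s)))); last by move=> l /eqP->.
rewrite -mulr_suml; apply: le_trans (ler_wpM2r (expR_ge0 _) (YP n).2).
rewrite big_const_seq count_predT iter_addr_0 -(mulr_natl (expR _)).
have -> : expR (- (n%:R * (s + d))) = expR (- (n%:R * s)) * r ^+ n.
  by rewrite mulrDr opprD expRD -(mulrN _ d) expRM_natl.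
by rewrite le_eqVlt; apply/orP; left; apply/eqP; ring.
Qed.

End WeightedCovers.

(** * A Frostman lemma for Feldman-Katok balls *)

Section FimfunLmodule.
Context {aT : Type} {K : realType}.

Lemma fimfun_scaler_closed : scaler_closed (@fimfun aT K).
Proof.
move=> a f; rewrite !inE/= => fA.
apply: sub_finite_set (finite_image (fun x => a * x) fA) => _ [x _ <-].
by exists (f x) => //; exists x.
Qed.

HB.instance Definition _ :=
  GRing.isScaleClosed.Build K (aT -> K) (@fimfun aT K) fimfun_scaler_closed.
HB.instance Definition _ :=
  [SubZmodule_isSubLmodule of {fimfun aT >-> K} by <:].

End FimfunLmodule.

Lemma fimfun_ubound {aT : Type} {R : realType} (f : {fimfun aT >-> R}) :
  exists2 M : R, 0 <= M & forall x, f x <= M.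
Proof.
have /finite_seqP[r fr] : finite_set (range f) by exact: fimfunP.
exists (\sum_(y <- r) `|y|); first exact: sumr_ge0.
move=> x; have : f x \in r by have : range f (f x) by []; rewrite fr.
move=> /(big_rem _)->/=; apply: le_trans (ler_norm _) _.
by rewrite lerDl sumr_ge0.
Qed.

Section Frostman.
Context {R : realType} {X : pmetricType R}.
Variables (T : X -> X) (K : set X) (N : nat) (e s : R).
Hypotheses (cX : compact [set: X]) (cT : continuous T) (cK : compact K).
Hypotheses (N0 : (0 < N)%N) (e0 : 0 < e).
Notation V := {fimfun X >-> R}.
Implicit Types (f g : V) (L : seq (R * (nat * X))).

(** In a weighted family [L] an entry [(c, (n, x))] stands for the ball
    [FKball T n x e] taken with coefficient [c]. *)
Definition dominates f L :=
  (forall l, l \in L -> (0 <= l.1) && (N <= l.2.1)%N) /\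
  (forall z, K z -> f z <= \sum_(l <- L) l.1 * \1_(FKball T l.2.1 l.2.2 e) z).

Definition cover_cost L := \sum_(l <- L) l.1 * expR (- (l.2.1%:R * s)).

Definition covering_functional f := inf [set cover_cost L | L in [set L | dominates f L]].

Local Notation p := covering_functional.

Let cover_cost_ge0 f L : dominates f L -> 0 <= cover_cost L.
Proof.
move=> [LN _]; rewrite /cover_cost big_seq; apply: sumr_ge0 => l /LN/andP[l0 _].
by rewrite mulr_ge0// expR_ge0.
Qed.

Let p_lb f L : dominates f L -> p f <= cover_cost L.
Proof.
move=> fL; apply: ge_inf; last by exists L.
by exists 0 => _ [M fM <-]; exact: cover_cost_ge0 fM.
Qed.

(** Compactness of [K] makes the covering functional real-valued. *)
Let dominated f : exists L, dominates f L.
Proof.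
have [M M0 fM] := fimfun_ubound f.
move: cK; rewrite compact_cover.
move=> /(_ X setT (fun x => FKball T N x e))[|z Kz|D _ KD].
- by move=> x _; exact: FKball_open.
- by exists z => //; exact: FKball_center.
exists [seq (M, (N, x)) | x <- finmap.enum_fset D]; split.
  by move=> _ /mapP[x _ ->] /=; rewrite M0 leqnn.
move=> z /KD[x /= xD xz]; rewrite big_map.
rewrite (big_rem x xD)/= indicE mem_set// mulr1.
apply: le_trans (fM z) _; rewrite lerDl; apply: sumr_ge0 => y _.
by rewrite mulr_ge0.
Qed.

Let p_glb f (c : R) : (forall L, dominates f L -> c <= cover_cost L) -> c <= p f.
Proof.
move=> h; apply: lb_le_inf; last by move=> _ [L fL <-]; exact: h.
by have [L fL] := dominated f; exists (cover_cost L), L.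
Qed.

Let p_sublinear : sublinear p.
Proof.
split=> [f g|t f t0].
  rewrite -lerBlDr; apply: p_glb => L fL; rewrite lerBlDr -lerBlDl.
  apply: p_glb => M gM; rewrite lerBlDl /cover_cost -big_cat; apply: p_lb.
  split=> [l|z Kz]; first by rewrite mem_cat => /orP[/fL.1|/gM.1].
  by rewrite big_cat /= lerD ?fL.2 ?gM.2.
rewrite -ler_pdivrMl//; apply: p_glb => L fL; rewrite ler_pdivrMl//.
rewrite (_ : t * _ = cover_cost [seq (t * l.1, l.2) | l <- L]).
  apply: p_lb; split=> [_ /mapP[l /fL.1/andP[l0 lN] ->]|z Kz] /=.
    by rewrite lN mulr_ge0// ltW.
  rewrite big_map/=; under eq_bigr do rewrite -mulrA.
  by rewrite -mulr_sumr; have := fL.2 z Kz; rewrite -(ler_pM2l t0).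
rewrite /cover_cost big_map mulr_sumr; apply: eq_bigr => l _; exact: mulrA.
Qed.

(** The empty family dominates a function that is nonpositive on [K]. Thus a
    linear functional below [p] is positive and supported by [K]. *)
Let p_le0 f : (forall z, K z -> f z <= 0) -> p f <= 0.
Proof.
move=> f0; rewrite -[leRHS](_ : cover_cost [::] = 0); last by rewrite /cover_cost big_nil.
by apply: p_lb; split=> // z Kz; rewrite big_nil f0.
Qed.

(** The ball [B_n(x, e)] is a weighted cover of its own indicator, of cost
    [exp (- n s)]; this is what bounds its mass, after normalization by the
    value [p 1 >= c] of the functional on the constant 1. *)
Lemma Frostman (c : R) : 0 < c ->
  (forall L, dominates (1 : V) L -> c <= cover_cost L) ->
  exists mu : borel_probability X, mu K = 1%E /\
    forall n x, (N <= n)%N ->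
      (mu (FKball T n x e) <= (expR (- (n%:R * s)) / c)%:E)%E.
Proof.
move=> c0 hc; have [F [FD Fp F1]] := Hahn_Banach (1 : V) p_sublinear.
have cF : c <= F 1 by rewrite F1; exact: p_glb.
have W0 : 0 < F 1 by exact: lt_le_trans cF.
have F0 : F 0 = 0 by have := FD 0 0; rewrite addr0; lra.
have FN f : F (- f) = - F f by have := FD f (- f); rewrite subrr F0; lra.
pose l A := F (indic_fimfun A) / F 1.
have l_ge0 A : 0 <= l A.
  apply: divr_ge0; last exact: ltW.
  rewrite -oppr_le0 -FN; apply: le_trans (Fp _) (p_le0 _) => z _.
  by rewrite fimfunN oppr_le0 /= indicE.
have l_add A B : A `&` B = set0 -> l (A `|` B) = l A + l B.
  move=> AB; rewrite /l -mulrDl -FD; congr (F _ / _).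
  apply/fimfuneqP => x; rewrite fimfunD/= !indicE in_setU.
  case: (boolP (x \in A)) (boolP (x \in B)) => xA [xB|xB] //=; rewrite ?addr0 ?add0r//.
  have : (A `&` B) x by split; exact: set_mem.
  by rewrite AB.
have l_T : l setT = 1.
  rewrite /l (_ : indic_fimfun setT = 1) ?divff ?gt_eqF//.
  by apply/fimfuneqP => x /=; rewrite indicE in_setT.
have l_K : l K = 1.
  have : l (~` K) <= 0.
    rewrite /l pmulr_lle0 ?invr_gt0//; apply: le_trans (Fp _) (p_le0 _) => z Kz.
    by rewrite /= indicE memNset//=.
  have := l_add K (~` K); rewrite setICr setUCr l_T => /(_ erefl).
  by have := l_ge0 (~` K); lra.
have hX := @metric_hausdorff R X.
have [mu [mu_open mu_closed]] := finitely_additive_regularization hX cX l_ge0 l_add l_T.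
have clK : closed K by exact: compact_closed.
exists mu; split.
  apply/eqP; rewrite eq_le probability_le1 /=; last first.
    rewrite -[K]setCK; apply: measurableC; apply: sub_sigma_algebra.
    exact: closed_openC.
  by rewrite -l_K; exact: mu_closed.
move=> n x Nn; apply: le_trans (mu_open _ (FKball_open _ _ _ cT)) _.
rewrite lee_fin /l; apply: (@le_trans _ _ (expR (- (n%:R * s)) / F 1)).
  rewrite ler_pM2r ?invr_gt0//; apply: le_trans (Fp _) _.
  have -> : expR (- (n%:R * s)) = cover_cost [:: (1, (n, x))].
    by rewrite /cover_cost big_seq1 mul1r.
  apply: p_lb; split=> [l'|z _]; first by rewrite inE => /eqP->/=; rewrite ler01 Nn.
  by rewrite big_seq1 mul1r.
by rewrite ler_wpM2l ?expR_ge0// lef_pV2 ?posrE.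
Qed.

End Frostman.

(** * Entropy and the covering quantity *)

Section LowerLimits.
Local Open Scope ereal_scope.
Context {R : realType}.
Implicit Types (u : (\bar R)^nat) (a : \bar R).

Lemma limn_einf_ge u a : (\forall n \near \oo, a <= u n) -> a <= limn_einf u.
Proof.
move=> ua; rewrite -[limn_einf u]/(limf_einf u \oo) limf_einfE.
apply: (@le_trans _ _ (ereal_inf (u @` [set n | a <= u n]))).
  by apply/ereal_infP => _ [n ? <-].
by apply: ereal_sup_ubound; exists [set n | a <= u n].
Qed.

Lemma limn_einf_gt u a : a < limn_einf u -> \forall n \near \oo, a < u n.
Proof.
rewrite -[limn_einf u]/(limf_einf u \oo) limf_einfE => /ereal_sup_gt[_ [V oV <-] aV].
apply: filterS oV => n Vn; apply: (lt_le_trans aV); apply: ereal_inf_lbound.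
by exists n.
Qed.

End LowerLimits.

Section Entropy.
Import HBNNSimple.
Local Open Scope ereal_scope.
Context {R : realType} {X : pmetricType R}.
Variable T : X -> X.
Implicit Types (mu : borel_probability X) (K : set X) (n N : nat) (e s : R) (x : X).

Lemma FK_local_entropy_ge mu N e s (c : R) x : (0 < c)%R ->
  (forall n, (N <= n)%N -> mu (FKball T n x e) <= (expR (- (n%:R * s)) / c)%:E) ->
  s%:E <= FK_local_entropy mu T x e.
Proof.
move=> c0 hmu; apply/lee_subgt0Pr => /= d d0; apply: limn_einf_ge.
near=> n.
have n0 : (0 < n%:R :> R)%R by rewrite ltr0n; near: n; exact: nbhs_infty_gt.
have b0 : (0 < expR (- (n%:R * s)) / c)%R by rewrite divr_gt0 ?expR_gt0.
set b := (expR _ / c)%R in b0.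
have h : mu (FKball T n x e) <= b%:E by apply: hmu; near: n; exact: nbhs_infty_ge.
have {}h : lne (mu (FKball T n x e)) <= lne b%:E.
  rewrite lee_lne//; rewrite in_itv/= leey andbT; first exact: measure_ge0.
  by rewrite lee_fin ltW.
rewrite leeNr -EFinN inver gt_eqF// lee_pdivrMr//.
apply: le_trans h _; rewrite lne_EFin// -EFinM lee_fin.
rewrite ln_div ?posrE ?expR_gt0// expRK.
have nd : (- ln c / d <= n%:R)%R by near: n; exact: nbhs_infty_ger.
move: nd; rewrite ler_pdivrMr// => nd.
by rewrite mulNr mulrBl (mulrC n%:R s) (mulrC d); lra.
Unshelve. all: by end_near. Qed.

Lemma local_entropy_gt mu e s x : s%:E < FK_local_entropy mu T x e ->
  exists N, forall n, (N < n)%N -> mu (FKball T n x e) <= (expR (- (n%:R * s)))%:E.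
Proof.
move=> /limn_einf_gt[N _ hN]; exists N => n Nn.
have n0 : (0 < n%:R :> R)%R by rewrite ltr0n (leq_ltn_trans _ Nn).
rewrite leNgt; apply/negP => /ltW h.
have := hN n (ltnW Nn); apply/negP; rewrite -leNgt.
rewrite leeNl -EFinN inver gt_eqF// lee_pdivlMr//.
rewrite -EFinM -[X in X <= _](_ : lne (expR (- (n%:R * s)))%:E = _).
  rewrite lee_lne// in_itv/= leey andbT; first by rewrite lee_fin expR_ge0.
  exact: measure_ge0.
by rewrite lne_EFin ?expR_gt0// expRK mulNr mulrC.
Qed.

Lemma FKM_N_ge0 K s N e : 0 <= FKM_N T K s N e.
Proof.
apply/ereal_infP => _ [I [n [x [_ _ ->]]]]; apply: esum_ge0 => i _.
by rewrite lee_fin expR_ge0.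
Qed.

Lemma FKM_N_le K s N N' e : (N <= N')%N -> FKM_N T K s N e <= FKM_N T K s N' e.
Proof.
move=> NN'; apply: le_ereal_inf => _ [I [n [x [In KI ->]]]].
exists I, n, x; split=> // i /In[n0 Nn]; split=> //; exact: leq_trans Nn.
Qed.

Lemma FKME K s e : FKM T K s e = ereal_sup (range (fun N => FKM_N T K s N e)).
Proof.
apply/cvg_lim => //; apply: ereal_nondecreasing_cvgn => m n; exact: FKM_N_le.
Qed.

Lemma FKM_eq0 K s N e : FKM T K s e = 0 -> FKM_N T K s N e = 0.
Proof.
rewrite FKME => h; apply/eqP; rewrite eq_le FKM_N_ge0 andbT -h.
by apply: ereal_sup_ubound; exists N.
Qed.

Lemma FKM_neq0 K s e : FKM T K s e <> 0 ->
  exists2 N, (0 < N)%N & 0 < FKM_N T K s N e.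
Proof.
move=> h; apply: contrapT => nN; apply: h.
apply/eqP; rewrite FKME eq_le; apply/andP; split; last first.
  by apply: le_trans (FKM_N_ge0 K s 0 e) _; apply: ereal_sup_ubound; exists 0%N.
apply: ge_ereal_sup => _ [N _ <-]; rewrite leNgt; apply/negP => N0.
by apply: nN; exists N.+1 => //; apply: lt_le_trans N0 _; exact: FKM_N_le.
Qed.

(** For a nonpositive exponent every ball of a cover costs at least 1. *)
Lemma FKM_eq0_gt0 K s e : K !=set0 -> FKM T K s e = 0 -> (0 < s)%R.
Proof.
move=> [z Kz] /(FKM_eq0 0) h; rewrite ltNge; apply/negP => s0.
suff : 1 <= FKM_N T K s 0 e by rewrite h lee_fin ler10.
apply/ereal_infP => _ [I [n [x [_ KI ->]]]].
have [i Ii _] := KI _ Kz.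
apply: esum_ge; exists [set i]; first by split=> // _ ->.
by rewrite fsbig_set1 lee_fin -expR0 ler_expR oppr_ge0 mulr_ge0_le0.
Qed.

Lemma FKM_critical_ge0 K e : K !=set0 -> 0 <= FKM_critical T K e.
Proof.
move=> K0; apply/ereal_infP => _ [s Ms <-].
by rewrite lee_fin ltW// (FKM_eq0_gt0 K0 Ms).
Qed.

Hypothesis cT : continuous T.

Let measurable_FKball n x e :
  measurable (FKball T n x e : set (g_sigma_algebraType (@open X))).
Proof. by apply: sub_sigma_algebra; exact: FKball_open. Qed.

Lemma FK_local_entropy_ge0 mu e x : 0 <= FK_local_entropy mu T x e.
Proof.
apply: (@FK_local_entropy_ge mu 0%N e 0%R 1%R) => // n _.
by rewrite mulr0 oppr0 expR0 divr1; exact: probability_le1.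
Qed.

Lemma FK_entropy_ge mu N e s (c : R) : (0 <= s)%R -> (0 < c)%R ->
  (forall n x, (N <= n)%N ->
    mu (FKball T n x e) <= (expR (- (n%:R * s)) / c)%:E) ->
  s%:E <= FK_entropy mu T e.
Proof.
move=> s0 c0 hmu; rewrite /FK_entropy ge0_integralTE; last first.
  by move=> x; exact: FK_local_entropy_ge0.
apply: ereal_sup_ubound; exists (cst_nnsfun _ (NngNum s0)).
  by move=> x /=; apply: (FK_local_entropy_ge c0) => n; exact: hmu.
rewrite -integralT_nnsfun/= integral_cst//.
rewrite [X in _ * X](_ : _ = 1) ?mule1//; exact: probability_setT.
Qed.

Lemma FK_entropy_ge0 mu e : 0 <= FK_entropy mu T e.
Proof. by apply: integral_ge0 => x _; exact: FK_local_entropy_ge0. Qed.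

(** A ball of radius [e] that contains a point [y] of the set lies in
    [B_n(y, 2 e)], hence weighs at most what it costs. *)
Lemma light_balls_negligible mu K N s e : FKM_N T K s N.+1 e = 0 ->
  mu.-negligible [set x | K x /\ forall n, (N < n)%N ->
    mu (FKball T n x (e + e)) <= (expR (- (n%:R * s)))%:E].
Proof.
move=> M0; set A := [set x | _].
have light_cover (d : R) : (0 < d)%R ->
    exists U : set (g_sigma_algebraType (@open X)),
      [/\ measurable U, A `<=` U & mu U <= d%:E].
  move=> d0; have : FKM_N T K s N.+1 e < d%:E by rewrite M0 lte_fin.
  move=> /ereal_inf_lt[_ [I [n [x [In KI ->]]]]] /ltW Id.
  (* only the mass of the balls that meet [A] is controlled *)
  pose F i := if `[< I i /\ FKball T (n i) (x i) e `&` A !=set0 >]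
    then FKball T (n i) (x i) e else set0.
  have mF i : measurable (F i : set (g_sigma_algebraType (@open X))).
    by rewrite /F; case: ifP.
  exists (\bigcup_i F i); split.
  - exact: bigcup_measurable.
  - move=> z Az; have [i Ii Fz] := KI _ Az.1; exists i => //.
    by rewrite /F asboolT//; split=> //; exists z.
  - apply: le_trans Id.
    apply: le_trans (measure_sigma_subadditive mu mF _ (@subset_refl _ _)) _.
      exact: bigcup_measurable.
    rewrite nneseries_esumT// [leRHS]esum_mkcond; apply: le_esum => i _.
    rewrite /F; case: asboolP => [[Ii [y [xy Ay]]]|_]; last first.
      by rewrite measure0; case: ifP => // _; rewrite lee_fin expR_ge0.
    rewrite mem_set//; apply: le_trans (Ay.2 _ (In _ Ii).2).
    apply: le_measure; rewrite ?inE//.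
    by move=> z; exact: FKball_triangle.
have /choice[U UP] (k : nat) : exists U : set (g_sigma_algebraType (@open X)),
    [/\ measurable U, A `<=` U & mu U <= (k.+1%:R^-1)%:E].
  by apply: light_cover; rewrite invr_gt0.
exists (\bigcap_k U k); split.
- by apply: bigcap_measurable => // k _; have [] := UP k.
- apply/eqP; rewrite -measure_le0; apply/lee_addgt0Pr => d d0; rewrite add0e.
  have [k kd] : exists k, (k.+1%:R^-1 <= d)%R.
    exists (Num.Def.archi_bound d^-1); rewrite invf_ple ?posrE//.
    apply: le_trans (ltW (archi_boundP _)) _; first by rewrite invr_ge0 ltW.
    by rewrite ler_nat.
  have [mUk _ Uk] := UP k; apply: (@le_trans _ _ (mu (U k))).
    apply: le_measure; rewrite ?inE//; last exact: bigcap_inf.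
    by apply: bigcap_measurable => // i _; have [] := UP i.
  by apply: le_trans Uk _; rewrite lee_fin.
- by move=> z Az k _; have [_ AU _] := UP k; exact: AU.
Qed.

(** The local entropy is at most [s] almost everywhere. The comparison is made on
    the simple functions below it, whose integrals have the entropy as supremum. *)
Lemma FK_entropy_le mu K s e : measurable (K : set (g_sigma_algebraType (@open X))) ->
  K !=set0 -> mu K = 1 -> FKM T K s e = 0 -> FK_entropy mu T (e + e) <= s%:E.
Proof.
move=> mK K0 muK M0; have s0 := FKM_eq0_gt0 K0 M0.
have hs : mu.-negligible (~` [set x | FK_local_entropy mu T x (e + e) <= s%:E]).
  pose E N : set (g_sigma_algebraType (@open X)) :=
    [set x | K x /\ forall n, (N < n)%N ->
      mu (FKball T n x (e + e)) <= (expR (- (n%:R * s)))%:E].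
  apply: (@negligibleS _ _ _ mu
    (~` (K : set (g_sigma_algebraType (@open X))) `|` \bigcup_N E N)).
    move=> x /= /negP; rewrite -ltNge => /local_entropy_gt[N hN].
    by have [Kx|nKx] := pselect (K x); [right; exists N|left].
  apply: negligibleU; last first.
    by apply: negligible_bigcup => N; apply: light_balls_negligible; exact: FKM_eq0.
  apply/negligibleP; first exact: measurableC.
  transitivity (1 - mu K); first exact: probability_setC.
  by rewrite muK subee.
rewrite /FK_entropy ge0_integralTE; last by move=> x; exact: FK_local_entropy_ge0.
apply: ge_ereal_sup => _ [h hh <-]; rewrite -integralT_nnsfun.
apply: (@le_trans _ _ (\int[mu]_x (cst s%:E) x)).
  apply: ae_ge0_le_integral => //.
  - by move=> x _; rewrite lee_fin.
  - exact/measurable_EFinP.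
  - by move=> x _; rewrite lee_fin ltW.
  - suff : mu.-negligible (~` [set x | setT x -> (h x)%:E <= s%:E]) by [].
    apply: negligibleS hs => x; apply: contra_not => hx _.
    exact: le_trans (hh x) hx.
rewrite integral_cst//.
by rewrite [X in _ * X](_ : _ = 1) ?mule1//; exact: probability_setT.
Qed.

End Entropy.

(** * Comparison of the critical exponent with the entropies *)

Section Comparison.
Local Open Scope ereal_scope.
Context {R : realType} {X : pmetricType R}.
Variables (T : X -> X) (K : set X).
Hypotheses (cX : compact [set: X]) (cT : continuous T).
Hypotheses (cK : compact K) (K0 : K !=set0).
Implicit Types (mu : borel_probability X) (e : R).

Definition sup_entropy e := ereal_sup [set FK_entropy mu T e
  | mu in [set mu : borel_probability X | mu K = 1]].

Let measurable_K : measurable (K : set (g_sigma_algebraType (@open X))).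
Proof.
rewrite -[K]setCK; apply: measurableC; apply: sub_sigma_algebra.
by apply: closed_openC; apply: compact_closed => //; exact: metric_hausdorff.
Qed.

Lemma sup_entropy_ge0 e : 0 <= sup_entropy e.
Proof.
have [z Kz] := K0.
pose mu : borel_probability X := dirac (z : g_sigma_algebraType (@open X)).
apply: le_trans (FK_entropy_ge0 cT mu e) _; apply: ereal_sup_ubound; exists mu => //.
by rewrite /mu/= diracE mem_set.
Qed.

Lemma sup_entropy_le_critical e : sup_entropy (e + e) <= FKM_critical T K e.
Proof.
apply: ge_ereal_sup => _ [mu muK <-]; apply/ereal_infP => _ [s Ms <-].
exact: FK_entropy_le Ms.
Qed.

(** If the covering quantity of exponent [r + d] does not vanish, half of [d] is
    spent on passing to weighted covers, and the Frostman measure has entropy at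
    least [r + d / 2], more than the supremum [r]. *)
Lemma critical_le_sup_entropy e : (0 < e)%R ->
  FKM_critical T K (e + e) <= sup_entropy e.
Proof.
move=> e0; have S0 := sup_entropy_ge0 e.
case ES : (sup_entropy e) => [r| |]; [|by rewrite leey|by rewrite ES in S0].
rewrite ES lee_fin in S0.
apply/lee_addgt0Pr => /= d d0; apply: ereal_inf_lbound; exists (r + d)%R => //=.
apply: contrapT => /FKM_neq0[N N0 MN].
pose s := (r + d / 2)%R.
have [c0 c00 c0M] : exists2 c0, (0 < c0)%R & c0%:E <= FKM_N T K (r + d) N (e + e).
  case: (FKM_N T K (r + d) N (e + e)) MN => [m| |]//.
    by rewrite lte_fin => m0; exists m.
  by move=> _; exists 1%R; rewrite ?leey.
have d20 : (0 < d / 2)%R by rewrite divr_gt0.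
have r1 : (0 < 1 - expR (- (d / 2)))%R by rewrite subr_gt0 expR_lt1 oppr_lt0.
have [|L [LN LK]|mu [muK muB]] := @Frostman R X T K N e s cX cT cK N0 e0
    (c0 * (1 - expR (- (d / 2))))%R.
- exact: mulr_gt0.
- rewrite -ler_pdivlMr// -lee_fin; apply: le_trans c0M _.
  have -> : (r + d)%R = (s + d / 2)%R by rewrite /s; lra.
  exact: weighted_cover_le.
have : s%:E <= sup_entropy e.
  apply: (@le_trans _ _ (FK_entropy mu T e)).
    apply: (@FK_entropy_ge _ _ _ cT mu N e s _ _ _ muB).
      by rewrite addr_ge0// ltW.
    exact: mulr_gt0.
  by apply: ereal_sup_ubound; exists mu.
by rewrite ES lee_fin /s; lra.
Qed.

End Comparison.

(** * Insensitivity of the logarithmic scale to halving *)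

Section LogScale.
Local Open Scope ereal_scope.
Context {R : realType}.
Implicit Types F H : R -> \bar R.

Lemma at_right0P (V : set R) :
  (0^'+)%R V -> exists2 d : R, (0 < d)%R & forall e, (0 < e < d)%R -> V e.
Proof.
move=> /nbhs_ballP[d d0 dV]; exists d => // e /andP[e0 ed]; apply: dV => //.
by rewrite /ball/= sub0r normrN gtr0_norm.
Qed.

(** If [F (e / 2) <= m ln (2 / e)] then [H e] exceeds [m ln (1 / e)] by at most
    [m ln 2], which is absorbed by any [t ln (1 / e)] when [e] is small. *)
Lemma limf_esup_log_le F H : (forall e, (0 < e)%R -> 0 <= F e) ->
  (forall e, (0 < e)%R -> H e <= F (e / 2)%R) ->
  limf_esup (fun e => H e / (ln (1 / e))%:E) (0^'+)%R <=
  limf_esup (fun e => F e / (ln (1 / e))%:E) (0^'+)%R.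
Proof.
move=> F0 HF; apply/ereal_infP => _ [V /at_right0P[d d0 dV] <-].
set M := ereal_sup _.
have logE e : (0 < e)%R -> (ln (1 / e) = - ln e)%R.
  by move=> e0; rewrite div1r lnV.
have FM e : (0 < e < d)%R -> (e < 1)%R -> F e <= M * (- ln e)%:E.
  move=> /[dup] ed /andP[e0 _] e1; have l0 : (0 < - ln e)%R.
    by rewrite oppr_gt0 ln_lt0// e0.
  have : F e / (ln (1 / e))%:E <= M by apply: ereal_sup_ubound; exists e => //; exact: dV.
  by rewrite logE// inver gt_eqF// lee_pdivrMr.
have M0 : 0 <= M.
  pose e := (Num.min (d / 2) 2^-1)%R.
  have e0 : (0 < e)%R by rewrite lt_min; apply/andP; split; lra.
  have ed : (e < d)%R by rewrite gt_min; apply/orP; left; lra.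
  have e1 : (e < 1)%R by rewrite gt_min; apply/orP; right; lra.
  have := le_trans (F0 _ e0) (FM e _ e1); rewrite e0 ed => /(_ isT).
  by rewrite pmule_lge0// lte_fin oppr_gt0 ln_lt0// e0.
case EM : M M0 => [m| |] M0; [|by rewrite leey|by []].
rewrite lee_fin in M0; apply/lee_addgt0Pr => /= t t0.
(* [e < exp (- c)] gives [m ln 2 <= t ln (1 / e)]; the added 1 keeps [c] positive *)
pose c := (m * ln 2 / t + 1)%R.
have c0 : (0 < c)%R.
  apply: ltr_wpDl => //; apply: divr_ge0 (ltW t0); apply: mulr_ge0 => //.
  by apply: ln_ge0; rewrite ler1n.
pose W := [set e : R | (0 < e /\ e < d) /\ (e < 1 /\ e < expR (- c))]%R.
apply: (@le_trans _ _ (ereal_sup [set H e / (ln (1 / e))%:E | e in W])).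
  apply: ereal_inf_lbound; exists W => //.
  near=> e; split; split; near: e.
  - exact: nbhs_right_gt.
  - exact: nbhs_right_lt.
  - exact: nbhs_right_lt.
  - by apply: nbhs_right_lt; exact: expR_gt0.
apply: ge_ereal_sup => _ [e [[e0 ed] [e1 ec]] <-].
have lc : (c < - ln e)%R by rewrite ltrNr -[X in (_ < X)%R]expRK ltr_ln ?posrE ?expR_gt0.
have l0 : (0 < - ln e)%R by exact: lt_trans lc.
rewrite logE// inver gt_eqF// lee_pdivrMr//.
apply: le_trans (HF e e0) _.
apply: le_trans (FM (e / 2)%R _ _) _; [lra|lra|].
rewrite EM -EFinD -!EFinM lee_fin ln_div ?posrE//.
have mt : (m * ln 2 <= - ln e * t)%R.
  by rewrite -ler_pdivrMr//; apply: le_trans (ltW lc); rewrite lerDl.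
by rewrite opprB mulrBr mulrDl mulrN (mulrC t); lra.
Unshelve. all: by end_near. Qed.

End LogScale.

Unset Implicit Arguments.
Local Open Scope ereal_scope.

(** * The variational principle *)

Theorem theorem1p1 (R : realType) (X : pmetricType R) (T : X -> X) (K : set X)
    (X_compact : compact [set: X]) (T_continuous : continuous T)
    (K_nonempty : K !=set0) (K_compact : compact K) :
  FK_upper_mdim_Bowen T K =
  limf_esup (fun eps : R =>
      ereal_sup [set FK_entropy mu T eps
                | mu in [set mu : borel_probability X | mu K = 1]]
      / (ln (1 / eps))%:E) 0%R^'+.
Proof.
apply/eqP; rewrite eq_le; apply/andP; split; apply: limf_esup_log_le => e e0.
- exact: sup_entropy_ge0.
- rewrite {1}(splitr e); apply: critical_le_sup_entropy => //.
  exact: divr_gt0.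
- exact: FKM_critical_ge0.
- by rewrite {1}(splitr e); exact: sup_entropy_le_critical.
Qed.
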